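(* Let $\alpha\in[0,1)$ and let $G$ be a strongly regular graph with parameters $(n,r,a,c)$ having $m$ edges. Put $$d=\{2r\alpha+(1-\alpha)(a-c)\}^2+4\{(r-c)(1-\alpha)^2-r\alpha(1-\alpha)(a-c)-r^2\alpha^2\}.$$ Then the $A_\alpha$-eigenvalues of $G$ are (i) $r$ with multiplicity $1$; (ii) $\dfrac{\{2r\alpha+(1-\alpha)(a-c)\}+\sqrt d}{2}$ with multiplicity $\dfrac12\left[(n-1)+\dfrac{\{2r\alpha+(1-\alpha)(a-c)\}(n-1)+2(r-2\alpha m)}{\sqrt d}\right]$; (iii) $\dfrac{\{2r\alpha+(1-\alpha)(a-c)\}-\sqrt d}{2}$ with multiplicity $\dfrac12\left[(n-1)-\dfrac{\{2r\alpha+(1-\alpha)(a-c)\}(n-1)+2(r-2\alpha m)}{\sqrt d}\right]$.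
   Context: Graphs are finite and simple. For a graph $G$ with adjacency matrix $A(G)$ and diagonal degree matrix $D(G)$, and $0\le\alpha\le1$, $A_\alpha(G)=\alpha D(G)+(1-\alpha)A(G)$; its eigenvalues are the $A_\alpha$-eigenvalues of $G$. An $r$-regular graph $G$ with $n$ vertices is strongly regular with parameters $(n,r,a,c)$ if any two adjacent vertices have exactly $a\ge 0$ common neighbours and any two (distinct) non-adjacent vertices have exactly $c\ge 0$ common neighbours.
   Formalization: The signs before the fraction in the multiplicities of (ii) and (iii) are interchanged, since as printed they fail for the 4-cycle with α=0; the graph is nonempty and d≠0 is assumed so that the division by √d makes sense. *)

(* Defs.v *)
From HB Require Import structures.
From mathcomp Require Import all_boot all_order all_algebra.
Set Implicit Arguments.
Unset Strict Implicit.
Unset Printing Implicit Defensive.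
Import Order.TTheory GRing.Theory Num.Theory.
Local Open Scope ring_scope.

Record sgraph := SGraph {
  vertex :> finType;
  adj : rel vertex;
  adj_sym : symmetric adj;
  adj_irrefl : irreflexive adj
}.

Definition nbhd (G : sgraph) (x : G) : {set G} := [set y | adj x y].

Definition degree (G : sgraph) (x : G) : nat := #|nbhd x|.

Definition edges (G : sgraph) : {set {set G}} :=
  [set [set p.1; p.2] | p in [set p : G * G | adj p.1 p.2]].

Definition regular (G : sgraph) (r : nat) : Prop :=
  forall x : G, degree x = r.

(* Complete and edgeless graphs are not excluded; for them c, resp. a, is an
   arbitrary natural number. *)
Definition strongly_regular (G : sgraph) (n r a c : nat) : Prop :=
  [/\ #|G| = n,
      regular G r,
      forall x y : G, adj x y -> #|nbhd x :&: nbhd y| = a &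
      forall x y : G, x != y -> ~~ adj x y -> #|nbhd x :&: nbhd y| = c].

(* Row and column i correspond to the vertex [enum_val i]. *)
Definition adjacency_mx (R : pzRingType) (G : sgraph) : 'M[R]_#|G| :=
  \matrix_(i, j) (adj (enum_val i) (enum_val j))%:R.

Definition degree_mx (R : pzRingType) (G : sgraph) : 'M[R]_#|G| :=
  diag_mx (\row_i (degree (enum_val i))%:R).

Definition Aalpha (R : pzRingType) (G : sgraph) (alpha : R) : 'M[R]_#|G| :=
  alpha *: degree_mx R G + (1 - alpha) *: adjacency_mx R G.

(* Main.v *)
(* Modulo the identity and A, the square of the adjacency matrix is a multiple
   of the all-ones matrix J, so M = Aalpha satisfies
   (M - theta)(M - tau) = k J, with M J = J M = r J.  Adding to M the multiple
   of J that moves the eigenvalue r on the all-ones vector to theta gives B with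
   (B - theta)(B - tau) = 0, so the characteristic polynomial of B is
   (X - theta)^f' (X - tau)^g.  A rank-one update moving a single eigenvalue
   only exchanges the corresponding linear factors of the characteristic
   polynomial, hence that of M is (X - r)(X - theta)^(f' - 1)(X - tau)^g.
   This also covers theta = r, as for disconnected G.  The trace then determines
   f' and g. *)

Require Import Defs.
From HB Require Import structures.
From mathcomp Require Import all_boot all_order all_algebra.
From mathcomp Require Import ring.
Import Order.TTheory GRing.Theory Num.Theory.
Local Open Scope ring_scope.

(** * Characteristic polynomials and rank-one perturbations *)

(** Two block eliminations evaluate the determinant of the same bordered matrix [B]. The extra
    factor [z] avoids both division and the exponent [n - 1]. *)
Lemma det_scalar_sub_rank1 (R : comNzRingType) (n : nat) (z : R)
    (u : 'cV[R]_n) (v : 'rV[R]_n) :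
  z * \det (z%:M - u *m v) = z ^+ n * (z - (v *m u) 0 0).
Proof.
set B : 'M_(n + 1) := block_mx z%:M u v 1%:M.
have det_l : \det B = \det (z%:M - u *m v).
  have eqB : B *m block_mx 1%:M 0 (- v) 1%:M
          = block_mx (z%:M - u *m v) u 0 1%:M.
    by rewrite mulmx_block !mulmx1 !mulmx0 mul1mx mulmxN subrr !add0r.
  have := congr1 determinant eqB.
  by rewrite det_mulmx det_ublock det_lblock !det1 !mulr1.
have det_r : \det B * z = z ^+ n * (z - (v *m u) 0 0).
  have eqB : B *m block_mx 1%:M (- u) 0 z%:M
          = block_mx z%:M 0 v (z%:M - v *m u).
    rewrite mulmx_block !mulmx1 !mulmx0 !addr0 mul1mx !mulmxN mul_scalar_mx.
    by rewrite mul_mx_scalar addNr addrC.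
  have := congr1 determinant eqB.
  rewrite det_mulmx det_ublock det_lblock det1 mul1r !det_scalar expr1 det_mx11.
  by rewrite !mxE mulr1n.
by rewrite -det_l mulrC.
Qed.

(** Since [u] is an eigenvector, (X - A)(z I - u v) = z (X - A - u v) with z = X - x; take
    determinants and cancel z^n. *)
Lemma char_poly_add_rank1 (R : idomainType) (n : nat) (A : 'M[R]_n)
    (u : 'cV[R]_n) (v : 'rV[R]_n) (x : R) :
  A *m u = x *: u ->
  char_poly (A + u *m v) * ('X - x%:P)
    = char_poly A * ('X - (x + (v *m u) 0 0)%:P).
Proof.
move=> Au; set z : {poly R} := 'X - x%:P.
pose U := map_mx (@polyC R) u; pose V := map_mx (@polyC R) v.
have AU : char_poly_mx A *m U = z *: U.
  by rewrite mulmxBl -map_mxM Au map_mxZ mul_scalar_mx scalerBl.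
have VU : (V *m U) 0 0 = ((v *m u) 0 0)%:P by rewrite -map_mxM mxE.
have eqM : char_poly_mx A *m (z%:M - U *m V) = z *: char_poly_mx (A + u *m v).
  rewrite mulmxBr mulmxA AU mul_mx_scalar -scalemxAl -scalerBr; congr (_ *: _).
  by rewrite /char_poly_mx map_mxD map_mxM opprD addrA.
have nz : z ^+ n != 0 by rewrite expf_neq0 // polyXsubC_eq0.
have := congr1 determinant eqM; rewrite det_mulmx detZ -!/(char_poly _) => E.
have := det_scalar_sub_rank1 _ _ z U V; rewrite VU => E'.
apply: (mulfI nz); rewrite mulrA -E -mulrA [_ * z]mulrC E' polyCD.
by rewrite opprD addrA mulrCA.
Qed.

(* With B = (x + y) I - A, the hypothesis reads
   (X - A)(X - B) = (X - x)(X - y) I; take determinants. *)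
Lemma char_poly_of_quadratic (F : fieldType) (n : nat) (A : 'M[F]_n) (x y : F) :
  (A - x%:M) *m (A - y%:M) = 0 ->
  exists k l : nat, char_poly A = ('X - x%:P) ^+ k * ('X - y%:P) ^+ l.
Proof.
move=> A0; pose B := (x + y)%:M - A.
have AB : char_poly_mx A *m char_poly_mx B = (('X - x%:P) * ('X - y%:P))%:M.
  have -> : char_poly_mx B = ('X - (x + y)%:P)%:M + map_mx polyC A.
    by rewrite /char_poly_mx map_mxB map_scalar_mx opprB addrCA addrC raddfB.
  have : map_mx polyC ((A - x%:M) *m (A - y%:M)) = 0 by rewrite A0 map_mx0.
  rewrite map_mxM !map_mxB !map_scalar_mx /=.
  set P := map_mx _ A; rewrite mulmxBl !mulmxBr mul_scalar_mx mul_mx_scalar.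
  rewrite -scalar_mxM => /eqP.
  rewrite -addrA addr_eq0 => /eqP PP.
  rewrite mulmxBl !mulmxDr PP -!scalar_mxM !mul_scalar_mx !mul_mx_scalar.
  apply/matrixP => i j; rewrite !mxE polyCD.
  by case: (i == j); rewrite ?mulr1n ?mulr0n; ring.
have dvd : char_poly A %| (('X - x%:P) * ('X - y%:P)) ^+ n.
  by rewrite -det_scalar -AB det_mulmx dvdp_mulr.
(* A monic divisor of a product of linear factors is the product over a subsequence of its roots,
   here all equal to [x] or [y]. *)
pose s := nseq n x ++ nseq n y.
have prodE (t : seq F) : {subset t <= [:: x; y]} ->
    exists k l : nat,
      \prod_(z <- t) ('X - z%:P) = ('X - x%:P) ^+ k * ('X - y%:P) ^+ l.
  elim: t => [|z t IH] st; first by exists 0, 0; rewrite big_nil mulr1.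
  have [|k [l E]] := IH; first by move=> w wt; apply: st; rewrite inE wt orbT.
  rewrite big_cons E; have := st z (mem_head _ _).
  rewrite !inE => /orP[] /eqP ->.
    by exists k.+1, l; rewrite exprS mulrA.
  by exists k, l.+1; rewrite exprS mulrCA.
have : char_poly A %| \prod_(z <- s) ('X - z%:P).
  by rewrite big_cat /= !big_nseq !iter_mulr_1 -exprMn.
case/dvdp_prod_XsubC => m.
rewrite eqp_monic ?char_poly_monic ?monic_prod_XsubC // => /eqP ->.
apply: prodE => z /mem_mask; rewrite mem_cat !mem_nseq !inE.
by case/orP => /andP[_ ->]; rewrite ?orbT.
Qed.

(** Compare degrees and subleading coefficients; the latter exist only for n > 0, so n = 0 is
    separate. *)
Lemma trace_of_char_poly (R : idomainType) (n : nat) (A : 'M[R]_n) (x y : R)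
    (k l : nat) :
  char_poly A = ('X - x%:P) ^+ k * ('X - y%:P) ^+ l ->
  (k + l)%N = n /\ \tr A = x *+ k + y *+ l.
Proof.
pose s := nseq k x ++ nseq l y.
have -> : ('X - x%:P) ^+ k * ('X - y%:P) ^+ l = \prod_(z <- s) ('X - z%:P).
  by rewrite big_cat !big_nseq !iter_mulr_1.
move=> E; have sz : size s = n.
  by have := size_char_poly A; rewrite E size_prod_XsubC => -[].
split; first by rewrite -sz size_cat !size_nseq.
have -> : x *+ k + y *+ l = \sum_(z <- s) z.
  by rewrite big_cat !big_nseq !iter_addr_0.
have [n0 | n_gt0] := posnP n.
  rewrite (size0nil (etrans sz n0)) big_nil /mxtrace big1 // => i _.
  by have := ltn_ord i; rewrite [X in (_ < X)%N]n0.
apply: oppr_inj; rewrite -char_poly_trace // E -coefPn_prod_XsubC ?sz //.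
by rewrite -lt0n.
Qed.

Lemma char_poly_quadratic_mod_rank1 (F : fieldType) (n : nat) (M : 'M[F]_n)
    (u : 'cV[F]_n) (v : 'rV[F]_n) (r x y k : F) :
  M *m u = r *: u -> v *m M = r *: v -> (v *m u) 0 0 != 0 ->
  (M - x%:M) *m (M - y%:M) = k *: (u *m v) -> x != y ->
  exists f g : nat,
    [/\ (f + g).+1 = n,
        \tr M = r + x *+ f + y *+ g &
        char_poly M = ('X - r%:P) * ('X - x%:P) ^+ f * ('X - y%:P) ^+ g].
Proof.
move=> Mu vM; set w := (v *m u) 0 0 => w0 Mxy neq_xy.
have vu : v *m u = w%:M by rewrite [LHS]mx11_scalar.
have uvuv : (u *m v) *m (u *m v) = w *: (u *m v).
  by rewrite -mulmxA (mulmxA v) vu mul_scalar_mx -scalemxAr.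
have v0 : v != 0 by apply: contraNneq w0 => v0; rewrite /w v0 mul0mx mxE.
have vMz z : v *m (M - z%:M) = (r - z) *: v.
  by rewrite mulmxBr vM mul_mx_scalar -scalerBl.
have Mzu z : (M - z%:M) *m u = (r - z) *: u.
  by rewrite mulmxBl Mu mul_scalar_mx -scalerBl.
have kw : k * w = (r - x) * (r - y).
  have : v *m ((M - x%:M) *m (M - y%:M)) = v *m (k *: (u *m v)) by rewrite Mxy.
  rewrite mulmxA vMz -scalemxAl vMz -scalemxAr mulmxA vu mul_scalar_mx !scalerA.
  move/eqP; rewrite -subr_eq0 -scalerBl scaler_eq0 (negPf v0) orbF subr_eq0.
  by move/eqP.
(* [t] solves r + t w = x, so that adding t u v moves the eigenvalue [r] to [x]. *)
pose t := (x - r) / w; have tw : t * w = x - r by rewrite mulfVK.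
pose B := M + (t *: u) *m v.
have Bxy : (B - x%:M) *m (B - y%:M) = 0.
  have -> : B - x%:M = M - x%:M + t *: (u *m v) by rewrite addrAC scalemxAl.
  have -> : B - y%:M = M - y%:M + t *: (u *m v) by rewrite addrAC scalemxAl.
  have := Mzu x; have := vMz y; move: Mxy.
  move: (M - x%:M) (M - y%:M) => P Q PQ vQ Pu.
  rewrite mulmxDl !mulmxDr PQ -!scalemxAl -!scalemxAr.
  rewrite mulmxA Pu -mulmxA vQ uvuv -scalemxAl -scalemxAr !scalerA -!scalerDl.
  rewrite [X in X *: _](_ : _ = 0) ?scale0r //.
  apply: (mulIf w0); rewrite mul0r.
  transitivity (k * w + (t * w) * (r - x + (r - y) + t * w)); first by ring.
  by rewrite kw tw; ring.
have vB : v *m B = x *: v.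
  by rewrite mulmxDr vM -scalemxAl -scalemxAr mulmxA vu mul_scalar_mx scalerA tw
             -scalerDl subrKC.
have [f [g EB]] := char_poly_of_quadratic _ _ _ _ _ Bxy.
have [szB trB] := trace_of_char_poly _ _ _ _ _ _ _ EB.
(* As x differs from y, this root forces a positive exponent of X - x, leaving one factor to
   exchange for X - r. *)
have : root (char_poly B) x.
  by rewrite -eigenvalue_root_char; apply/eigenvalueP; exists v.
case: f => [|f] in EB szB trB *.
  case: g => [|g] in EB szB trB *; first by rewrite EB mulr1 (negPf (root1 _)).
  by rewrite EB mul1r root_exp_XsubC (negPf neq_xy).
move=> _; exists f, g; split; first by rewrite -addSn.
  have : \tr B = \tr M + (x - r).
    by rewrite linearD /= mxtrace_mulC -scalemxAr linearZ /= trace_mx11 -/w tw.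
  rewrite trB mulrS => E; apply: (addIr (x - r)); rewrite -E; ring.
have MtU : M *m (t *: u) = r *: (t *: u).
  by rewrite -scalemxAr Mu !scalerA mulrC.
have := char_poly_add_rank1 _ _ _ _ v _ MtU.
rewrite -/B -scalemxAr mxE -/w tw subrKC EB exprS -!mulrA.
have Xx0 : 'X - x%:P != 0 by rewrite polyXsubC_eq0.
move=> E; apply: (mulIf Xx0); rewrite -E; ring.
Qed.

(** * Edge counts and the adjacency matrix *)

Lemma sum_degree (G : sgraph) : (\sum_(x : G) degree x = 2 * #|edges G|)%N.
Proof.
transitivity #|[set p : G * G | adj p.1 p.2]|.
  rewrite -sum1dep_card.
  rewrite -(pair_big_dep xpredT (fun x y : G => adj x y) (fun _ _ => 1%N)) /=.
  by apply: eq_bigr => x _; rewrite sum1dep_card.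
(* Group the ordered adjacent pairs by their edge: each fibre is (x, y) and (y, x), distinct because
   [adj] is irreflexive. *)
rewrite -sum1_card (partition_big_imset (fun p : G * G => [set p.1; p.2])) /=.
rewrite mulnC -sum_nat_const; apply: eq_bigr => _ /imsetP[[x y] + ->] /=.
rewrite inE /= => xy; have neq_xy : x != y.
  by apply: contraTneq xy => ->; rewrite adj_irrefl.
have neq_p : (x, y) != (y, x) by rewrite xpair_eqE negb_and neq_xy.
rewrite sum1_card.
transitivity #|[set (x, y); (y, x)]|; last by rewrite cards2 neq_p.
apply: eq_card => -[x' y']; rewrite unfold_in /= in_set in_set2 /= !xpair_eqE.
apply/andP/idP => [[x'y' /eqP E] | ].
  have: x' \in [set x; y] by rewrite -E !inE eqxx.
  have: y' \in [set x; y] by rewrite -E !inE eqxx orbT.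
  rewrite !inE => /orP[] /eqP Ey /orP[] /eqP Ex; move: x'y';
    by rewrite Ex Ey ?adj_irrefl // !eqxx ?orbT.
by case/orP => /andP[/eqP-> /eqP->]; rewrite ?xy 1?adj_sym ?xy // setUC.
Qed.

Lemma regular_edges (G : sgraph) (r : nat) :
  regular G r -> (#|G| * r = 2 * #|edges G|)%N.
Proof.
by move=> reg; rewrite -sum_degree (eq_bigr (fun=> r)) ?sum_nat_const //.
Qed.

Lemma adjacency_mx_const1 (R : comNzRingType) (G : sgraph) (r : nat) :
  regular G r ->
  adjacency_mx R G *m const_mx 1 = r%:R *: (const_mx 1 : 'cV_#|G|).
Proof.
move=> reg; apply/matrixP => i j; rewrite !mxE mulr1 -(reg (enum_val i)).
under eq_bigr => k _ do rewrite !mxE mulr1.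
rewrite -(big_enum_val (fun y => (adj (enum_val i) y)%:R)) /=.
rewrite -natr_sum /degree -sum1_card [in RHS]big_mkcond /=; congr _%:R.
by apply: eq_bigr => y _; rewrite inE; case: (adj _ _).
Qed.

Lemma tr_adjacency_mx (R : comNzRingType) (G : sgraph) :
  (adjacency_mx R G)^T = adjacency_mx R G.
Proof. by apply/matrixP => i j; rewrite !mxE adj_sym. Qed.

Lemma adjacency_mx_sqrE (R : comNzRingType) (G : sgraph) (i j : 'I_#|G|) :
  (adjacency_mx R G *m adjacency_mx R G) i j
    = #|nbhd (enum_val i) :&: nbhd (enum_val j)|%:R.
Proof.
rewrite !mxE; under eq_bigr => k _ do rewrite !mxE -natrM mulnb.
rewrite -(big_enum_val
  (fun y => (adj (enum_val i) y && adj y (enum_val j))%:R)) /=.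
rewrite -natr_sum -sum1_card [in RHS]big_mkcond /=; congr _%:R.
by apply: eq_bigr => y _; rewrite !inE [adj y _]adj_sym; case: (_ && _).
Qed.

Lemma adjacency_mx_sqr (R : comNzRingType) (G : sgraph) (n r a c : nat) :
  strongly_regular G n r a c ->
  let A := adjacency_mx R G in
  A *m A = r%:R%:M + a%:R *: A + c%:R *: (const_mx 1 - 1%:M - A).
Proof.
move=> [_ reg Ga Gc] A; apply/matrixP => i j; rewrite adjacency_mx_sqrE !mxE.
have [<- | neq_ij] := eqVneq i j.
  by rewrite adj_irrefl setIid -/(degree _) reg !mulr1n mulr0n; ring.
have neq_v : enum_val i != enum_val j by rewrite (inj_eq enum_val_inj).
have [adj_ij | adj_ij] := boolP (adj _ _).
  by rewrite Ga // !mulr1n !mulr0n; ring.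
by rewrite Gc // !mulr0n; ring.
Qed.

Lemma Aalpha_regular (R : comNzRingType) (G : sgraph) (r : nat) (alpha : R) :
  regular G r ->
  Aalpha G alpha = (alpha * r%:R)%:M + (1 - alpha) *: adjacency_mx R G.
Proof.
move=> reg; rewrite /Aalpha; congr (_ + _).
apply/matrixP => i j; rewrite !mxE reg.
by case: (i == j); rewrite ?mulr1n // !mulr0n mulr0.
Qed.

Lemma trace_Aalpha (R : comNzRingType) (G : sgraph) (alpha : R) :
  \tr (Aalpha G alpha) = 2 * alpha * #|edges G|%:R.
Proof.
rewrite linearD !linearZ /=.
have -> : \tr (adjacency_mx R G) = 0.
  by apply: big1 => i _; rewrite mxE adj_irrefl.
rewrite mulr0 addr0 mxtrace_diag mulrAC -natrM -sum_degree mulrC natr_sum.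
rewrite (big_enum_val (fun x : G => (degree x)%:R)).
by under eq_bigr => i _ do rewrite mxE.
Qed.

Lemma complete_common_nbhd (G : sgraph) (r a : nat) (x y : G) :
  (forall x y : G, x != y -> adj x y) -> regular G r ->
  #|nbhd x :&: nbhd y| = a -> x != y -> r = a.+1.
Proof.
move=> complete reg <- neq_xy; rewrite -(reg x) /degree (cardsD1 y).
rewrite inE complete // add1n; congr _.+1; apply: eq_card => z; rewrite !inE.
have [-> | neq_zy] := eqVneq z y; first by rewrite adj_irrefl andbF.
by rewrite [adj y z]complete ?andbT // eq_sym.
Qed.

(** A non-adjacent pair gives c <= r. Otherwise the graph is complete, r = a + 1, and the expression
    is the square of a - c + 2. *)
Lemma strongly_regular_discr_ge0 (R : realDomainType) (G : sgraph)
    (n r a c : nat) :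
  strongly_regular G n r a c -> (1 < n)%N ->
  0 <= (a%:R - c%:R) ^+ 2 + 4 * (r%:R - c%:R) :> R.
Proof.
move=> [<- reg Ga Gc] /card_gt1P[x0 [y0 [_ _ neq_xy0]]].
have [/existsP[[x y] /= /andP[neq_xy nadj]] | /existsPn complete] :=
  boolP [exists p : G * G, (p.1 != p.2) && ~~ adj p.1 p.2].
  have : (c <= r)%N.
    by rewrite -(Gc _ _ neq_xy nadj) -(reg x) subset_leq_card ?subsetIl.
  rewrite -(ler_nat R) => le_cr.
  by rewrite addr_ge0 ?sqr_ge0 // mulr_ge0 // subr_ge0.
have {}complete (x y : G) : x != y -> adj x y.
  by move=> neq; have := complete (x, y); rewrite /= neq negbK.
have a_xy := Ga _ _ (complete _ _ neq_xy0).
rewrite (complete_common_nbhd _ _ _ _ _ complete reg a_xy) //.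
rewrite (_ : _ + _ = (a%:R - c%:R + 2) ^+ 2) ?sqr_ge0 // -natr1; ring.
Qed.

(* The eigenvalues are listed with multiplicity, so coinciding values (such as
   r and theta when G is disconnected) have their multiplicities added.
   The hypothesis [d != 0] only makes the two quotients by [Num.sqrt d]
   meaningful: d = 0 occurs only for edgeless or complete graphs with a
   degenerate choice of the unconstrained parameters.
   Since r + f * theta + g * tau = \tr (Aalpha G alpha) = 2 * alpha * m and
   f + g = n - 1, the fraction q enters the multiplicity f of the larger value
   theta with the sign -, and the multiplicity g of tau with the sign +; the
   opposite assignment is refuted by the 4-cycle with alpha = 0. *)
Theorem theorem3p1 (R : rcfType) (alpha : R) (G : sgraph) (n r a c m : nat)
    (halpha : 0 <= alpha < 1)
    (hn : (0 < n)%N)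
    (hG : strongly_regular G n r a c)
    (hm : #|edges G| = m) :
  let s : R := 2 * r%:R * alpha + (1 - alpha) * (a%:R - c%:R) in
  let d : R :=
    s ^+ 2 + 4 * ((r%:R - c%:R) * (1 - alpha) ^+ 2
                  - r%:R * alpha * (1 - alpha) * (a%:R - c%:R)
                  - r%:R ^+ 2 * alpha ^+ 2) in
  let theta : R := (s + Num.sqrt d) / 2 in
  let tau : R := (s - Num.sqrt d) / 2 in
  let q : R :=
    (s * (n%:R - 1) + 2 * (r%:R - 2 * alpha * m%:R)) / Num.sqrt d in
  d != 0 ->
  exists f g : nat,
    [/\ f%:R = 2^-1 * ((n%:R - 1) - q),
        g%:R = 2^-1 * ((n%:R - 1) + q) &
        char_poly (Aalpha G alpha) =
          ('X - (r%:R)%:P) * ('X - theta%:P) ^+ f * ('X - tau%:P) ^+ g].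
Proof.
move=> s d theta tau q d0.
have [card_G reg _ _] := hG.
pose A := adjacency_mx R G; pose M := Aalpha G alpha.
have ME : M = (alpha * r%:R)%:M + (1 - alpha) *: A by apply: Aalpha_regular.
have trM : \tr M = 2 * alpha * m%:R by rewrite -hm trace_Aalpha.
pose u : 'cV[R]_#|G| := const_mx 1; pose v : 'rV[R]_#|G| := const_mx 1.
have Mu : M *m u = r%:R *: u.
  rewrite ME mulmxDl mul_scalar_mx -scalemxAl (adjacency_mx_const1 _ _ r) //.
  by rewrite scalerA -scalerDl; congr (_ *: _); ring.
have vM : v *m M = r%:R *: v.
  apply: trmx_inj; rewrite trmx_mul linearZ /= !trmx_const.
  have -> : M^T = M.
    by rewrite ME linearD linearZ /= tr_scalar_mx tr_adjacency_mx.
  exact: Mu.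
have uvE : u *m v = const_mx 1.
  by apply/matrixP => i j; rewrite !mxE big_ord1 !mxE mulr1.
have vuE : (v *m u) 0 0 = n%:R.
  rewrite mxE; under eq_bigr => i _ do rewrite !mxE mulr1.
  by rewrite sumr_const card_ord card_G.
(* For n = 1 the parameters a and c are arbitrary and d may be negative. *)
case: (ltngtP n 1) => [|n_gt1|n1]; first by rewrite ltnNge hn.
- have d_gt0 : 0 < d.
    rewrite lt_neqAle eq_sym d0 /=.
    have -> : d = (1 - alpha) ^+ 2 * ((a%:R - c%:R) ^+ 2 + 4 * (r%:R - c%:R)).
      by rewrite /d /s; ring.
    by rewrite mulr_ge0 ?sqr_ge0 // (strongly_regular_discr_ge0 _ _ _ _ _ _ hG).
  pose e := Num.sqrt d; have e2 : e ^+ 2 = d by rewrite sqr_sqrtr // ltW.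
  have e0 : e != 0 by rewrite gt_eqF // sqrtr_gt0.
  have neq : theta != tau.
    by rewrite -subr_eq0 (_ : _ - _ = e) // /theta /tau -/e; field.
  have Mq : (M - theta%:M) *m (M - tau%:M)
            = ((1 - alpha) ^+ 2 * c%:R) *: (u *m v).
    have Mz z : M - z%:M = (alpha * r%:R - z)%:M + (1 - alpha) *: A.
      by rewrite ME addrAC -raddfB.
    (* The values of x + y and x y cancel the terms in [A] and the identity once A^2 is expanded,
       leaving only the multiple of the all-ones matrix. *)
    set x := alpha * r%:R - theta; set y := alpha * r%:R - tau.
    have xy_sum : x + y = - ((1 - alpha) * (a%:R - c%:R)).
      by rewrite /x /y /theta /tau /s; field.
    have xy_prod : x * y = - ((1 - alpha) ^+ 2 * (r%:R - c%:R)).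
      transitivity ((alpha * r%:R - s / 2) ^+ 2 - e ^+ 2 / 4).
        by rewrite /x /y /theta /tau -/e; field.
      by rewrite e2 /d /s; field.
    rewrite uvE !Mz -/x -/y mulmxDl !mulmxDr -scalar_mxM xy_prod.
    rewrite mul_scalar_mx mul_mx_scalar -scalemxAl -scalemxAr.
    rewrite (adjacency_mx_sqr R G _ _ _ _ hG) -addrA [X in _ + X]addrA.
    rewrite -scalerDl xy_sum scalerA -/A.
    apply/matrixP => i j; rewrite !mxE.
    by case: (i == j); rewrite ?mulr1n ?mulr0n; ring.
  have [|f [g [fg tr cp]]] :=
    char_poly_quadratic_mod_rank1 _ _ _ _ _ _ _ _ _ Mu vM _ Mq neq.
    by rewrite vuE pnatr_eq0 -lt0n.
  exists f, g; rewrite trM in tr; rewrite card_G in fg.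
  have nE : n%:R - 1 = f%:R + g%:R :> R by rewrite -fg -natr1 natrD addrK.
  (* By the trace, the numerator of [q] is s (f + g) - 2 (f theta + g tau) = (g - f) e. *)
  have qE : q = g%:R - f%:R.
    apply: (mulIf e0); rewrite mulfVK // nE tr.
    rewrite -[theta *+ f]mulr_natr -[tau *+ g]mulr_natr /theta /tau -/e.
    by field.
  by split=> //; rewrite qE nE; field.
have all_eq (x y : G) : x = y.
  have /card_le1_eqP eq_G : (#|G| <= 1)%N by rewrite card_G n1.
  exact: eq_G.
have r0 : r = 0%N.
  have /card_gt0P[x0 _] : (0 < #|G|)%N by rewrite card_G n1.
  rewrite -(reg x0); apply: eq_card0 => y; rewrite inE (all_eq y x0).
  exact: adj_irrefl.
have m0 : m = 0%N.
  have := regular_edges _ _ reg; rewrite r0 muln0 hm => /esym/eqP.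
  by rewrite muln_eq0 => /eqP.
(* The numerator vanishes, so the value of [Num.sqrt d] is irrelevant. *)
have q0 : q = 0 by rewrite /q n1 r0 m0; ring.
exists 0%N, 0%N; rewrite q0 n1 !expr0 !mulr1; split; try by ring.
have -> : Aalpha G alpha = r%:R%:M.
  have uv1 : u *m v = 1%:M.
    rewrite uvE; apply/matrixP => i j; rewrite !mxE.
    by rewrite (enum_val_inj (all_eq (enum_val i) (enum_val j))) eqxx.
  by rewrite -/M -[M]mulmx1 -uv1 mulmxA Mu -scalemxAl uv1 scalemx1.
by rewrite /char_poly /char_poly_mx map_scalar_mx -raddfB det_scalar card_G n1.
Qed.
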